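(* Let $m\ge 2$ be an even integer. Then all palindromes in $V(\mathcal D^*_m)$ (binary words $v=b_1\cdots b_m\in V(\mathcal D^*_m)$ with $b_i=b_{m+1-i}$ for all $i$) belong to the component $\mathcal A^*_m$ of $\mathcal D^*_m$ containing the vertex $1^m=11\cdots1$ (which, for even $m$, coincides with the component $\mathcal R^*_m$ containing the vertex $0^m=00\cdots0$).
   Context: Components are weakly connected components. Digraph $\mathcal D_m$: let $\mathcal D_{ud}$ be the digraph on $\{a,b,c,d,e,f\}$ with arcs from each of $a,b,d$ to each of $b,c,f$, and from each of $c,e,f$ to each of $a,d,e$; let $\mathcal D_{lr}$ be the digraph on the same letters with arcs from each of $a,c,e$ to each of $d,e,f$, and from each of $b,d,f$ to each of $a,b,c$. $V(\mathcal D_m)$ is the set of words $\alpha_1\cdots\alpha_m$ over $\{a,b,c,d,e,f\}$ with $\alpha_1\in\{a,d,e\}$, $\alpha_m\in\{c,e,f\}$ and each $(\alpha_i,\alpha_{i+1})$, $1\le i\le m-1$, an arc of $\mathcal D_{ud}$. There is an arc $\alpha_1\cdots\alpha_m\to\beta_1\cdots\beta_m$ in $\mathcal D_m$ iff every $(\alpha_i,\beta_i)$ is an arc of $\mathcal D_{lr}$. Digraph $\mathcal D^*_m$: the outlet word of $\alpha=\alpha_1\cdots\alpha_m\in V(\mathcal D_m)$ is the binary word $o(\alpha)=o_1\cdots o_m$ with $o_j=0$ if $\alpha_j\in\{b,d,f\}$ and $o_j=1$ if $\alpha_j\in\{a,c,e\}$. Then $V(\mathcal D^*_m)=\{o(\alpha):\alpha\in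 V(\mathcal D_m)\}$, and there is a (single) arc $v\to w$ in $\mathcal D^*_m$ iff there are $x,y\in V(\mathcal D_m)$ with $x\to y$ in $\mathcal D_m$, $o(x)=v$, $o(y)=w$ (loops allowed). *)

(* Defs.v *)
From HB Require Import structures.
From mathcomp Require Import all_boot.

Set Implicit Arguments.
Unset Strict Implicit.
Unset Printing Implicit Defensive.

Inductive letter := La | Lb | Lc | Ld | Le | Lf.

Definition letter_code (x : letter) : 'I_6 :=
  match x with
  | La => inord 0 | Lb => inord 1 | Lc => inord 2
  | Ld => inord 3 | Le => inord 4 | Lf => inord 5
  end.

Definition letter_decode (i : 'I_6) : letter :=
  nth La [:: La; Lb; Lc; Ld; Le; Lf] i.

Lemma letter_codeK : cancel letter_code letter_decode.
Proof. by case; rewrite /letter_decode /letter_code inordK. Qed.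

HB.instance Definition _ := Finite.copy letter (can_type letter_codeK).

Definition arc_ud : rel letter := fun x y =>
  (x \in [:: La; Lb; Ld]) && (y \in [:: Lb; Lc; Lf])
  || (x \in [:: Lc; Le; Lf]) && (y \in [:: La; Ld; Le]).

Definition arc_lr : rel letter := fun x y =>
  (x \in [:: La; Lc; Le]) && (y \in [:: Ld; Le; Lf])
  || (x \in [:: Lb; Ld; Lf]) && (y \in [:: La; Lb; Lc]).

(* The default letter of [head] and [last] matters only when m = 0. *)
Definition V_D (m : nat) : {set m.-tuple letter} :=
  [set w : m.-tuple letter |
    [&& head La w \in [:: La; Ld; Le],
        last La w \in [:: Lc; Le; Lf]
      & sorted arc_ud w]].

Definition arc_D (m : nat) : rel (m.-tuple letter) := fun x y =>
  [&& x \in V_D m, y \in V_D m & [forall i, arc_lr (tnth x i) (tnth y i)]].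

(* Binary digits are booleans: [true] is 1 and [false] is 0. *)
Definition outlet (m : nat) (x : m.-tuple letter) : m.-tuple bool :=
  [tuple tnth x i \in [:: La; Lc; Le] | i < m].

Definition V_Dstar (m : nat) : {set m.-tuple bool} := @outlet m @: V_D m.

Definition arc_Dstar (m : nat) : rel (m.-tuple bool) := fun v w =>
  [exists x in V_D m, exists y in V_D m,
    [&& arc_D x y, outlet x == v & outlet y == w]].

Definition weakly_connected (T : finType) (e : rel T) : rel T :=
  connect [rel x y | e x y || e y x].

(* Meaningful for v in V_Dstar m, where it is the component containing v. *)
Definition component_Dstar (m : nat) (v : m.-tuple bool) : {set m.-tuple bool} :=
  [set w in V_Dstar m | weakly_connected (@arc_Dstar m) v w].

Definition ones (m : nat) : m.-tuple bool := [tuple of nseq m true].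
Definition zeros (m : nat) : m.-tuple bool := [tuple of nseq m false].

Definition palindrome (m : nat) (v : m.-tuple bool) : Prop :=
  forall i : 'I_m, tnth v i = tnth v (rev_ord i).

(* Main.v *)
Require Import Defs.
From mathcomp Require Import all_boot.

(** A letter is a cell of a grid in which exactly two of the four sides are
    crossed by an edge: [La] = right and down, [Lb] = up and down, [Lc] = up
    and right, [Ld] = left and down, [Le] = left and right, [Lf] = left and up.
    A word of [V_D m] is a column of such cells with no edge leaving at its top
    or bottom, and its outlet word records the edges leaving on the right.
    Reflecting a column exchanges its left and right edges, so [v] and [w] are
    adjacent in the outlet digraph as soon as one column has left edges [v] and
    right edges [w]; equivalently, as soon as there are vertical edges
    [u 0], ..., [u m], with [u 0] and [u m] absent, such that every cell [i]
    satisfies v_i + w_i + u_i + u_(i+1) = 2 ([arc_Dstar_of_edges]).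

    Let [m] be even. Alternating vertical edges join every word to its
    complement ([arc_compl]); in particular every word is a vertex. Delaying the
    alternation at two positions [i < j] leaves the bits [i] and [j] unchanged
    and complements the others ([arc_compl_except]); this is possible when v_i
    differs from the parity of [i] and v_j agrees with that of [j], positions
    being counted from 0. Followed by a complement, this flips exactly the bits
    [i] and [j]. In terms of the twisted bits v_i + i mod 2, two different
    entries are exchanged, and arbitrary exchanges of this kind stay within a
    component ([flip2_connected]).

    In a palindrome of even length, mirror positions carry equal bits but have
    opposite parities, so their twisted bits differ and a mirror pair of zeros
    may be turned into a pair of ones. Repeating this reaches the word of ones;
    it applies in particular to the word of zeros. *)

Set Implicit Arguments.
Unset Strict Implicit.
Unset Printing Implicit Defensive.

Definition letter_index (x : letter) : nat :=
  match x with La => 0 | Lb => 1 | Lc => 2 | Ld => 3 | Le => 4 | Lf => 5 end.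

(** The canonical equality test of [letter] goes through [inord] and does not
    compute; the test on indices does. *)
Lemma letter_eqE (x y : letter) : (x == y) = (letter_index x == letter_index y).
Proof. by apply/eqP/eqP => [-> //|]; case: x; case: y. Qed.

Lemma arc_udE x y :
  arc_ud x y = ((x \in [:: La; Lb; Ld]) == (y \in [:: Lb; Lc; Lf])).
Proof. by rewrite /arc_ud !inE !letter_eqE; case: x; case: y. Qed.

Lemma arc_lrE x y :
  arc_lr x y = ((x \in [:: La; Lc; Le]) == (y \in [:: Ld; Le; Lf])).
Proof. by rewrite /arc_lr !inE !letter_eqE; case: x; case: y. Qed.

(** The right side is not an argument because the other three determine it. The
    triples with three equal entries, for which no such cell exists, get values
    with a wrong left side. *)
Definition cell (up down left : bool) : letter :=
  if up then if down then Lb else if left then Lf else Lc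
  else if down then if left then Ld else La else Le.

Definition two_sides (l r p d : bool) := l + r + p + d == 2.

Lemma two_sidesC l r p d : two_sides l r p d = two_sides r l p d.
Proof. by rewrite /two_sides (addnC l). Qed.

Lemma cell_up l r p d :
  two_sides l r p d -> (cell p d l \in [:: Lb; Lc; Lf]) = p.
Proof. by rewrite !inE !letter_eqE; case: l; case: r; case: p; case: d. Qed.

Lemma cell_down l r p d :
  two_sides l r p d -> (cell p d l \in [:: La; Lb; Ld]) = d.
Proof. by rewrite !inE !letter_eqE; case: l; case: r; case: p; case: d. Qed.

Lemma cell_left l r p d :
  two_sides l r p d -> (cell p d l \in [:: Ld; Le; Lf]) = l.
Proof. by rewrite !inE !letter_eqE; case: l; case: r; case: p; case: d. Qed.

Lemma cell_right l r p d :
  two_sides l r p d -> (cell p d l \in [:: La; Lc; Le]) = r.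
Proof. by rewrite !inE !letter_eqE; case: l; case: r; case: p; case: d. Qed.

Definition column m (u : nat -> bool) (v : m.-tuple bool) : m.-tuple letter :=
  [tuple cell (u i) (u i.+1) (tnth v i) | i < m].

Section Column.

Variables (m : nat) (u : nat -> bool) (v w : m.-tuple bool).
Hypotheses (m_gt0 : 0 < m) (u0 : u 0 = false) (um : u m = false).
Hypothesis two_uvw :
  forall i : 'I_m, two_sides (tnth v i) (tnth w i) (u i) (u i.+1).

Lemma column_V_D : column u v \in V_D m.
Proof.
have nthE k (lt_km : k < m) :
    nth La (column u v) k = cell (u k) (u k.+1) (tnth v (Ordinal lt_km)).
  by rewrite -[k]/(val (Ordinal lt_km)) -tnth_nth tnth_mktuple.
have not_up x : (x \in [:: La; Ld; Le]) = (x \notin [:: Lb; Lc; Lf]).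
  by rewrite !inE !letter_eqE; case: x.
have not_down x : (x \in [:: Lc; Le; Lf]) = (x \notin [:: La; Lb; Ld]).
  by rewrite !inE !letter_eqE; case: x.
rewrite inE -nth0 -nth_last size_tuple not_up not_down; apply/and3P; split.
- by rewrite (nthE _ m_gt0) (cell_up (two_uvw (Ordinal m_gt0))) u0.
- have lt_m1m : m.-1 < m by rewrite prednK.
  by rewrite (nthE _ lt_m1m) (cell_down (two_uvw (Ordinal lt_m1m))) prednK // um.
- apply/(sortedP La) => k; rewrite size_tuple => lt_k1m.
  rewrite (nthE _ (ltnW lt_k1m)) (nthE _ lt_k1m) arc_udE.
  rewrite (cell_down (two_uvw (Ordinal (ltnW lt_k1m)))).
  by rewrite (cell_up (two_uvw (Ordinal lt_k1m))).
Qed.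

Lemma outlet_column : outlet (column u v) = w.
Proof.
by apply: eq_from_tnth => i; rewrite !tnth_mktuple (cell_right (two_uvw i)).
Qed.

End Column.

(** The source column of the arc is the mirror image of its target column, which
    has left edges [v] and right edges [w]. *)
Lemma arc_Dstar_of_edges m (u : nat -> bool) (v w : m.-tuple bool) :
    0 < m -> u 0 = false -> u m = false ->
    (forall i : 'I_m, two_sides (tnth v i) (tnth w i) (u i) (u i.+1)) ->
  arc_Dstar v w.
Proof.
move=> m_gt0 u0 um uvw.
have uwv i : two_sides (tnth w i) (tnth v i) (u i) (u i.+1).
  by rewrite two_sidesC.
have Vx := column_V_D m_gt0 u0 um uwv; have Vy := column_V_D m_gt0 u0 um uvw.
apply/exists_inP; exists (column u w) => //.
apply/exists_inP; exists (column u v) => //.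
rewrite (outlet_column uwv) (outlet_column uvw) !eqxx /arc_D Vx Vy !andbT /=.
apply/forallP => i; rewrite arc_lrE !tnth_mktuple.
by rewrite (cell_right (uwv i)) (cell_left (uvw i)).
Qed.

Lemma arc_Dstar_V m (v w : m.-tuple bool) : arc_Dstar v w -> v \in V_Dstar m.
Proof.
case/exists_inP=> x Vx /exists_inP[y _ /and3P[_ /eqP <- _]].
exact: imset_f.
Qed.

Definition compl m (v : m.-tuple bool) : m.-tuple bool := [tuple of map negb v].

Definition flip2 m (i j : 'I_m) (v : m.-tuple bool) : m.-tuple bool :=
  [tuple tnth v k (+) (k \in pred2 i j) | k < m].

Lemma flip2C m (i j : 'I_m) v : flip2 i j v = flip2 j i v.
Proof.
by apply: eq_from_tnth => k; rewrite !tnth_mktuple !inE orbC.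
Qed.

Lemma flip2K m (i j : 'I_m) : involutive (flip2 i j).
Proof.
by move=> v; apply: eq_from_tnth => k; rewrite !tnth_mktuple addbK.
Qed.

Section EvenLength.

Variable m : nat.
Hypotheses (m_gt0 : 0 < m) (m_even : ~~ odd m).
Implicit Types v : m.-tuple bool.

Lemma arc_compl v : arc_Dstar v (compl v).
Proof.
apply: (@arc_Dstar_of_edges _ odd) => //; first exact: negbTE.
by move=> k; rewrite tnth_map /=; case: (tnth v k); case: (odd k).
Qed.

Lemma V_Dstar_even v : v \in V_Dstar m.
Proof. exact: arc_Dstar_V (arc_compl v). Qed.

(** Take vertical edges that alternate except across the cells [i] and [j]: a
    cell with exactly one vertical edge has exactly one horizontal edge, whereas
    at [i] and [j] the two vertical edges are equal and both horizontal edges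
    must take the opposite value. *)
Lemma arc_compl_except v (i j : 'I_m) :
    i < j -> tnth v i (+) odd i -> ~~ (tnth v j (+) odd j) ->
  arc_Dstar v (compl (flip2 i j v)).
Proof.
move=> lt_ij vi vj.
apply: (@arc_Dstar_of_edges _ (fun k => odd k (+) (i < k <= j))) => //.
  by rewrite (negbTE m_even) [m <= j]leqNgt !ltn_ord.
move=> k; rewrite tnth_map tnth_mktuple inE /= !ltnS.
have [-> | neq_ki] := eqVneq k i.
  move: vi; rewrite ltnn leqnn lt_ij /=.
  by case: (tnth v i); case: (odd i).
have [-> | neq_kj] := eqVneq k j.
  move: vj; rewrite lt_ij leqnn ltnn (ltnW lt_ij) /=.
  by case: (tnth v j); case: (odd j).
have -> : (i <= k) = (i < k) by rewrite leq_eqVlt eq_sym val_eqE (negbTE neq_ki).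
have -> : (k <= j) = (k < j) by rewrite leq_eqVlt val_eqE (negbTE neq_kj).
by case: (tnth v k); case: (odd k); case: (i < k < j).
Qed.

Notation wconn := (weakly_connected (@arc_Dstar m)).

Lemma wconn_sym : connect_sym [rel x y | @arc_Dstar m x y || arc_Dstar y x].
Proof. by apply: sym_connect_sym => x y /=; rewrite orbC. Qed.

Lemma wconn_arc v w : arc_Dstar v w -> wconn v w.
Proof. by move=> vw; apply: connect1; rewrite /= vw. Qed.

Lemma wconn_compl v : wconn (compl v) v.
Proof. by rewrite /weakly_connected wconn_sym; apply/wconn_arc/arc_compl. Qed.

(** One of the two orders of the twisted bits allows the move of
    [arc_compl_except] from [v], followed by a complement; the other order allows
    the same two steps in the opposite direction, since flipping the two bits
    also reverses their order. *)
Lemma flip2_connected v (i j : 'I_m) :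
    tnth v i (+) odd i != tnth v j (+) odd j ->
  wconn v (flip2 i j v).
Proof.
have direct v' (i' j' : 'I_m) :
    i' < j' -> tnth v' i' (+) odd i' -> ~~ (tnth v' j' (+) odd j') ->
    wconn v' (flip2 i' j' v').
  move=> lt_ij vi vj; apply: connect_trans (wconn_compl _).
  exact: wconn_arc (arc_compl_except lt_ij vi vj).
wlog lt_ij : i j / i < j => [IH neq_ij|].
  have [lt_ij | lt_ji | /val_inj eq_ij] := ltngtP i j; first exact: IH.
    by rewrite flip2C; apply: IH; rewrite // eq_sym.
  by rewrite eq_ij eqxx in neq_ij.
case: (boolP (tnth v i (+) odd i)) => vi; case: (boolP (_ (+) _)) => vj // _.
  exact: direct.
rewrite /weakly_connected wconn_sym -[X in connect _ _ X](flip2K i j v).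
apply: direct => //; rewrite tnth_mktuple !inE eqxx ?orbT addbT addNb //.
by rewrite negbK.
Qed.

Lemma odd_rev_ord (i : 'I_m) : odd (rev_ord i) = ~~ odd i.
Proof. by rewrite /= oddB ?ltn_ord //= (negbTE m_even). Qed.

(** Each step turns a mirror pair of zeros into ones, which keeps the word a
    palindrome and lowers its number of zeros. *)
Lemma palindrome_ones v : palindrome v -> wconn v (ones m).
Proof.
have [n] := ubnP #|[set i | ~~ tnth v i]|; elim: n v => // n IH v le_n pal_v.
have [/existsP[i vi0] | /existsPn all1] := boolP [exists i, ~~ tnth v i].
  have vr0 : ~~ tnth v (rev_ord i) by rewrite -pal_v.
  apply: connect_trans (flip2_connected (i := i) (j := rev_ord i) _) _.
    by rewrite -pal_v odd_rev_ord; case: (tnth v i); case: (odd i).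
  apply: IH => [|k].
    apply: leq_trans (_ : _ < #|[set k | ~~ tnth v k]|) le_n.
    apply: proper_card; apply/properP; split; last first.
      by exists i; rewrite inE // tnth_mktuple !inE eqxx addbT vi0.
    apply/subsetP => k; rewrite !inE tnth_mktuple !inE.
    have [-> | _] := eqVneq k i; first by rewrite vi0.
    by have [-> | _] := eqVneq k (rev_ord i); rewrite ?vr0 ?addbF.
  have rev_eq j : (rev_ord k == j) = (k == rev_ord j).
    by rewrite -(inj_eq rev_ord_inj) rev_ordK.
  by rewrite !tnth_mktuple -pal_v !inE !rev_eq rev_ordK orbC.
suff -> : v = ones m by exact: connect0.
by apply: eq_from_tnth => i; rewrite tnth_nseq; have /negPn := all1 i.
Qed.

End EvenLength.

Theorem theorem3p18 (m : nat) (hm : 2 <= m) (hev : ~~ odd m) :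
  [/\ ones m \in V_Dstar m,
      zeros m \in V_Dstar m,
      component_Dstar (ones m) = component_Dstar (zeros m)
    & forall v : m.-tuple bool,
        v \in V_Dstar m -> palindrome v -> v \in component_Dstar (ones m)].
Proof.
have m_gt0 : 0 < m by exact: ltnW.
split; try exact: V_Dstar_even.
  have zeros_ones : weakly_connected (@arc_Dstar m) (zeros m) (ones m).
    by apply: palindrome_ones => // i; rewrite !tnth_nseq.
  apply/setP => w; rewrite !inE /weakly_connected.
  by rewrite (same_connect (@wconn_sym m) zeros_ones).
move=> v Vv pal_v; rewrite inE Vv /weakly_connected wconn_sym.
exact: palindrome_ones.
Qed.
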